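(* Let $\phi$ be the Laplace exponent (Bernstein function, not identically zero) of a potentially killed driftless subordinator whose Lévy measure $\mu$ has positive increase, and let $\phi_*(z)=z/\phi(z)$ for $\mathrm{Re}(z)>0$. Then for any $\eta>0$ there exist $a_\eta>0$ and $C_\eta>0$ such that for all $t\ge\eta$ and $a\ge a_\eta$, $$\arg\bigl(a(1+it)\bigr)-\arg\phi\bigl(a(1+it)\bigr)=\arg\phi_*\bigl(a(1+it)\bigr)\ge\frac{C_\eta}{t},$$ or equivalently $\arg\phi(a(1+it))\le\arctan(t)-C_\eta/t$. Moreover, if in addition $\limsup_{x\to0+}\bar\mu(2x)/\bar\mu(x)<1$, then for any $\eta>0$ there exist $a'_\eta>0$ and $\varepsilon_\eta>0$ such that for all $t\ge\eta$ and $a\ge a'_\eta$, $$\arg\bigl(a(1+it)\bigr)-\arg\phi\bigl(a(1+it)\bigr)=\arg\phi_*\bigl(a(1+it)\bigr)\ge\varepsilon_\eta,$$ or equivalently $\arg\phi(a(1+it))\le\arctan(t)-\varepsilon_\eta$.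
   Context: A potentially killed subordinator has Laplace exponent $$\phi(z)=q+dz+\int_0^\infty(1-e^{-zy})\,\mu(\mathrm dy)=q+dz+z\int_0^\infty e^{-zy}\bar\mu(y)\,\mathrm dy,\qquad\mathrm{Re}(z)\ge0,$$ with $q,d\ge0$, $\mu$ a measure on $(0,\infty)$ with $\int_0^\infty\min\{y,1\}\mu(\mathrm dy)<\infty$, and $\bar\mu(y)=\mu((y,\infty))$. Driftless means $d=0$. Positive increase means $$\liminf_{x\to0+}\frac{\int_0^{2x}\bar\mu(y)\,\mathrm dy}{\int_0^x\bar\mu(y)\,\mathrm dy}>1,\quad\text{equivalently}\quad\limsup_{x\to\infty}\frac{x\phi'(x)}{\phi(x)}<1.$$ $\arg$ takes values in $(-\pi,\pi]$. *)

(* Defs.v *)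
From HB Require Import structures.
From mathcomp Require Import all_boot all_order all_algebra.
From mathcomp Require Import complex.
From mathcomp Require Import all_classical all_reals all_analysis.
From mathcomp Require Import ring lra.
Set Implicit Arguments.
Unset Strict Implicit.
Unset Printing Implicit Defensive.
Import Order.TTheory GRing.Theory Num.Theory numFieldNormedType.Exports.
Local Open Scope classical_set_scope.
Local Open Scope complex_scope.
Local Open Scope ring_scope.

Definition cexp (R : realType) (z : R[i]) : R[i] :=
  (expR (complex.Re z) * cos (complex.Im z)) +i*
  (expR (complex.Re z) * sin (complex.Im z)).

(* Principal argument with values in (-pi, pi], see [cargP]; [carg 0 = 0] by
   convention. *)
Definition carg (R : realType) (z : R[i]) : R :=
  if z == 0 then 0
  else if 0 <= complex.Im z then acos (complex.Re z / Normc.normc z)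
  else - acos (complex.Re z / Normc.normc z).

Lemma cargP (R : realType) (z : R[i]) : z != 0 ->
  - pi < carg z <= pi /\
  z = (Normc.normc z)%:C * cexp (0 +i* carg z).
Proof.
move=> z0; rewrite /carg (negbTE z0); case: z z0 => x y z0 /=.
set r := Num.sqrt _.
have s0 : 0 < x ^+ 2 + y ^+ 2.
  rewrite lt_neqAle addr_ge0 ?sqr_ge0// andbT eq_sym.
  rewrite paddr_eq0 ?sqr_ge0// !sqrf_eq0.
  by apply: contraNN z0 => /andP[/eqP-> /eqP->].
have r0 : 0 < r by rewrite sqrtr_gt0.
have rE : r ^+ 2 = x ^+ 2 + y ^+ 2 by rewrite sqr_sqrtr// ltW.
have xr : x / r * r = x by rewrite divfK// gt_eqF.
have sq : (x / r) ^+ 2 + (y / r) ^+ 2 = 1.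
  by rewrite !exprMn -mulrDl -rE exprVn divff// expf_neq0// gt_eqF.
have xr1 : -1 <= x / r <= 1.
  have : (x / r) ^+ 2 <= 1 by have := sqr_ge0 (y / r); lra.
  by move=> h; apply/andP; split; nra.
have sE : sin (acos (x / r)) = `|y| / r.
  rewrite sin_acos// (_ : 1 - _ = (y / r) ^+ 2); last by lra.
  by rewrite sqrtr_sqr normrM normfV (gtr0_norm r0).
have rV : r * (x / r) = x by rewrite mulrC.
have yV (u : R) : r * (u / r) = u by rewrite mulrC divfK// gt_eqF.
have pi0 := pi_gt0 R; have a0 := acos_ge0 xr1; have a1 := acos_lepi xr1.
case: ifPn => y0.
  split; first by apply/andP; split => //; lra.
  rewrite /cexp /= expR0 !mul1r sE acosK ?in_itv//=; simpc.
  by rewrite rV yV ger0_norm.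
have y_lt0 : y < 0 by rewrite ltNge.
have x1 : -1 < x / r.
  rewrite lt_neqAle; case/andP: (xr1) => -> _; rewrite andbT.
  apply/eqP => x1; move: sq; rewrite -x1 sqrrN expr1n => /eqP.
  rewrite -subr_eq0 addrC addrA addNr add0r sqrf_eq0 mulf_eq0 invr_eq0.
  by rewrite (gt_eqF r0) (lt_eqF y_lt0).
have a2 : acos (x / r) < pi.
  by rewrite acos_ltpi// x1 /=; case/andP: xr1.
split; first by apply/andP; split; lra.
rewrite /cexp /= expR0 !mul1r cosN sinN sE acosK ?in_itv//=; simpc.
by rewrite rV yV ltr0_norm// opprK.
Qed.

Definition cintegral (R : realType)
    (mu : {measure set (measurableTypeR R) -> \bar R})
    (D : set R) (f : R -> R[i]) : R[i] :=
  (\int[mu]_(y in D) complex.Re (f y)) +i* (\int[mu]_(y in D) complex.Im (f y)).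

(* A measure on (0, oo) is represented by a Borel measure on R of which only the
   restriction to (0, oo) is ever used. *)
Definition levy_measure (R : realType)
    (mu : {measure set (measurableTypeR R) -> \bar R}) : Prop :=
  (\int[mu]_(y in `]0%R, +oo[) (Num.min y 1)%:E < +oo)%E.

Definition is_laplace_exponent (R : realType) (q d : R)
    (mu : {measure set (measurableTypeR R) -> \bar R})
    (phi : R[i] -> R[i]) : Prop :=
  [/\ 0 <= q, 0 <= d, levy_measure mu &
    forall z : R[i], 0 <= complex.Re z ->
      phi z = q%:C + d%:C * z +
              cintegral mu `]0, +oo[ (fun y => 1 - cexp (- z * y%:C))].

Definition phi_star (R : realType) (phi : R[i] -> R[i]) (z : R[i]) : R[i] :=
  z / phi z.

Definition levy_tail (R : realType)
    (mu : {measure set (measurableTypeR R) -> \bar R}) (y : R) : \bar R :=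
  mu `]y, +oo[%classic.

Definition int_levy_tail (R : realType)
    (mu : {measure set (measurableTypeR R) -> \bar R}) (x : R) : \bar R :=
  (\int[lebesgue_measure]_(y in `]0%R, x]) levy_tail mu y)%E.

(* The quotient is taken in \bar R, where 0 / 0 = 0: a measure vanishing on
   (0, oo) does not have positive increase. *)
Definition positive_increase (R : realType)
    (mu : {measure set (measurableTypeR R) -> \bar R}) : Prop :=
  (1 < limf_einf
    (fun x : R => int_levy_tail mu (2 * x)%R / int_levy_tail mu x) 0%R^'+)%E.

Definition levy_tail_ratio_lt1 (R : realType)
    (mu : {measure set (measurableTypeR R) -> \bar R}) : Prop :=
  (limf_esup (fun x : R => levy_tail mu (2 * x)%R / levy_tail mu x) 0%R^'+ < 1)%E.

(* Main.v *)
From HB Require Import structures.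
Require Import Defs.
From mathcomp Require Import all_boot all_order all_algebra.
From mathcomp Require Import complex.
From mathcomp Require Import all_classical all_reals all_analysis.
From mathcomp Require Import measurable_realfun ring lra.
Set Implicit Arguments.
Unset Strict Implicit.
Unset Printing Implicit Defensive.
Import Order.TTheory GRing.Theory Num.Theory numFieldNormedType.Exports.
Local Open Scope classical_set_scope.
Local Open Scope complex_scope.
Local Open Scope ring_scope.

(** Write [X + i Y] for the value of the exponent at [z = a (1 + i t)]. Its real part
    is positive, so both arguments are values of [atan] and their difference is the
    argument of [z / (X + i Y)], whose sine is
    [(t X - Y) / (|1 + i t| |X + i Y|)]. As an angle in [(- pi, pi)] with
    nonnegative sine is at least its sine, everything reduces to bounding
    [t X - Y] below by a multiple of [|X| + |Y|] ([carg_gap]).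

    The function [t X - Y] is [t q] plus the integral against [mu] of
    [arg_kernel t (a y)], a nonnegative kernel which is bounded below for
    [a t y >= 2] ([arg_kernel_ge]) and is of order [t] for [2 <= a t y <= 4]
    ([arg_kernel_window]). With [x = 2 / (a t)] and [T] the tail of [mu],
    this gives the lower bounds [t q + c T(x)] and
    [t q + c t (T(x) - T(2 x))] ([arg_exponent_ge], [arg_exponent_window]).
    In the other direction [|X| + |Y|] is at most
    [q + C J(x) / x], where [J(x)] is the integral of [min (y, x)] against [mu]
    ([exponent_le]); by Tonelli's theorem [J(x)] is the integral of [T] over
    [(0, x]] ([int_levy_tailE]).

    Positive increase is what makes [J(x) / x] and [T(x)] comparable for small [x]:
    from [b J(x) <= J(2 x) <= J(x) + x T(x)] with [b > 1] follows
    [(b - 1) J(x) <= x T(x)] ([positive_increase_truncated_mean]). Hence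
    [t X - Y] dominates [|X| + |Y|], and the argument is at least of order
    [1 / (1 + t)]. If moreover [T(2 x) <= r T(x)] with [r < 1], the second lower bound
    is of order [t (q + T(x))]; the extra factor [t] turns [1 / (1 + t)] into a
    constant. *)

(** * Trigonometric estimates *)

Section trigonometry.
Context {R : realType}.
Implicit Types eta t u v x y : R.

Lemma normr_sin_le v : 0 <= v -> `|sin v| <= v.
Proof.
move=> v0.
have [c _] := @MVT_segment _ _ cos _ _ v0 (fun x _ => is_derive_sin x)
  (continuous_subspaceT (@continuous_sin R)).
by rewrite sin0 !subr0 => ->; rewrite normrM (ger0_norm v0) ler_piMl// cos_max.
Qed.

Lemma one_sub_cos_le v : 0 <= v -> 1 - cos v <= v.
Proof.
move=> v0.
have [c _] := @MVT_segment _ _ (fun x => - sin x) _ _ v0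
  (fun x _ => is_derive_cos x) (continuous_subspaceT (@continuous_cos R)).
by rewrite cos0 !subr0 => h; have := sin_le1 c; nra.
Qed.

Lemma cos_anti x y : 0 <= x -> x <= y -> y <= pi -> cos y <= cos x.
Proof.
by move=> x0 xy ypi; rewrite leNgt ltr_cos -?leNgt ?in_itv/=//; lra.
Qed.

Lemma one_add_cos2_gt0 : 0 < 1 + cos (2 : R).
Proof.
by rewrite -[2 : R]/(1 *+ 2) cos_mulr2n; have := cos1_gt0 R; nra.
Qed.

(** Since [2 <= pi < 4], the interval [[2, 4]] stays away from the zeros [0] and
    [2 pi] of [1 - cos]. *)
Lemma one_sub_cos_ge v : 2 <= v <= 4 -> 1 + cos 2 <= 1 - cos v.
Proof.
move=> /andP[v2 v4]; have p2 := pi_ge2 R; have c0 := cos2_lt0 R.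
have [vpi|piv] := leP v pi.
  by have := @cos_anti 2 v _ v2 vpi; lra.
rewrite -[v in leRHS](subrK pi) cosDpi lerD2l opprK; apply: cos_anti => //; lra.
Qed.

(** The real and imaginary parts of [1 - exp(- z y)] for [z = a (1 + i t)], as
    functions of [u = a y]. *)
Definition re_kernel t u : R := 1 - expR (- u) * cos (t * u).
Definition im_kernel t u : R := expR (- u) * sin (t * u).

Lemma re_kernel_ge t u : 0 <= u -> 1 - expR (- u) <= re_kernel t u.
Proof.
by move=> u0; rewrite lerD2l lerN2 ler_piMr ?expR_ge0// cos_le1.
Qed.

Lemma re_kernel_le eta t u : 0 < eta -> eta <= t -> 0 <= u ->
  `|re_kernel t u| <= (1 + eta^-1) * Num.min (t * u) 2.
Proof.
move=> eta0 etat u0; have e1 : expR (- u) <= 1 by rewrite -expR0 ler_expR oppr_le0.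
have e0 := expR_ge0 (- u); have e2 := expR_ge1Dx (- u).
have tu0 : 0 <= t * u by rewrite mulr_ge0//; lra.
have c1 := one_sub_cos_le tu0; have c2 := cos_le1 (t * u).
have c3 := cos_geN1 (t * u).
rewrite ger0_norm; last by apply: le_trans (re_kernel_ge _ u0); rewrite subr_ge0.
have i0 : 0 < eta^-1 by rewrite invr_gt0.
rewrite /re_kernel minr_pMr; last by lra.
rewrite le_min; apply/andP; split; last by nra.
have h1 : u <= eta^-1 * (t * u).
  by rewrite mulrA ler_peMl// mulrC ler_pdivlMr// mul1r.
have h2 : expR (- u) * (1 - cos (t * u)) <= 1 * (t * u) by rewrite ler_pM// subr_ge0.
lra.
Qed.

Lemma im_kernel_le t u : 0 <= t -> 0 <= u ->
  `|im_kernel t u| <= Num.min (t * u) 2.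
Proof.
move=> t0 u0; have e1 : expR (- u) <= 1 by rewrite -expR0 ler_expR oppr_le0.
rewrite /im_kernel normrM ger0_norm ?expR_ge0//.
apply: (@le_trans _ _ `|sin (t * u)|); first by rewrite ler_piMl.
rewrite le_min normr_sin_le ?mulr_ge0//=.
by rewrite (le_trans (sin_max _))// ler1n.
Qed.

(** This is [Im (z * conj (1 - exp(- z y))) / a]: a positive value says that
    [1 - exp(- z y)] has a smaller argument than [z]. *)
Definition arg_kernel t u : R := t * re_kernel t u - im_kernel t u.

Lemma arg_kernelE t u : arg_kernel t u =
  expR (- u) * (t * (expR u - 1) - sin (t * u) + t * (1 - cos (t * u))).
Proof.
have e : expR (- u) * expR u = 1 by rewrite -expRD addNr expR0.
rewrite /arg_kernel /re_kernel /im_kernel; transitivity (t * (expR (- u) * expR u) -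
  expR (- u) * (t * cos (t * u) + sin (t * u))); first by rewrite e; ring.
by ring.
Qed.

(** Since [u <= exp u - 1], one has [sin (t u) <= t u <= t (exp u - 1)]. *)
Lemma arg_kernel_ge0 t u : 0 <= t -> 0 <= u -> 0 <= arg_kernel t u.
Proof.
move=> t0 u0; rewrite arg_kernelE mulr_ge0 ?expR_ge0//.
have tu0 : 0 <= t * u by rewrite mulr_ge0.
have e := expR_ge1Dx u; have s := le_trans (ler_norm _) (normr_sin_le tu0).
have c : 0 <= t * (1 - cos (t * u)) by rewrite mulr_ge0// subr_ge0 cos_le1.
have : t * u <= t * (expR u - 1) by rewrite ler_wpM2l//; lra.
lra.
Qed.

(** For [t u >= 2] the sine is at most half of [t u], hence at most half of
    [t (exp u - 1)], so the kernel is at least [t (exp u - 1) / (2 exp u)]. This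
    increases with [exp u - 1], which exceeds [1 / t]. *)
Lemma arg_kernel_ge eta t u : 0 < eta -> eta <= t -> 2 <= t * u ->
  eta / (2 * (1 + eta)) <= arg_kernel t u.
Proof.
move=> eta0 etat tu2; rewrite arg_kernelE.
have t0 : 0 < t by lra.
have e := expR_ge1Dx u; have s := sin_le1 (t * u).
have c : 0 <= t * (1 - cos (t * u)).
  by rewrite mulr_ge0 ?subr_ge0 ?cos_le1// ltW.
have tE : t * u <= t * (expR u - 1) by rewrite ler_wpM2l ?(ltW t0)//; lra.
have E0 := expR_gt0 u.
rewrite expRN ler_pdivrMr ?mulr_gt0//; last by lra.
rewrite -mulrA mulrC ler_pdivlMr//.
set E := expR u in e tE E0 *.
have X2 : 2 <= t * (E - 1) by lra.
have E1 : 0 <= E - 1 by rewrite -(pmulr_rge0 _ t0); lra.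
have e1 : eta * (E - 1) <= t * (E - 1) by rewrite ler_wpM2r.
have e2 : eta * 1 <= eta * (t * (E - 1)) by rewrite ler_pM2l//; lra.
have : t * (E - 1) / 2 <= t * (E - 1) - sin (t * u) + t * (1 - cos (t * u)).
  by lra.
by nra.
Qed.

(** While [arg_kernel_ge] is bounded in [t], the term [t (1 - cos (t u))] makes the
    kernel of order [t] as long as [t u] stays away from [0] and [2 pi]. *)
Lemma arg_kernel_window t u : 0 < t -> 2 <= t * u <= 4 ->
  t * Num.min (1 / 2) (1 + cos 2) <= arg_kernel t u.
Proof.
move=> t0 tu; have m := one_sub_cos_ge tu; case/andP: tu => tu2 tu4.
set c := Num.min _ _.
have [c1 c2] : c <= 1 / 2 /\ c <= 1 + cos 2 by rewrite !ge_min !lexx orbT.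
rewrite arg_kernelE.
have e := expR_ge1Dx u; have s := sin_le1 (t * u).
have tE : t * u <= t * (expR u - 1) by rewrite ler_wpM2l ?(ltW t0)//; lra.
have E0 := expR_gt0 u.
rewrite expRN [leRHS]mulrC ler_pdivlMr//.
set E := expR u in e tE E0 *.
have tE0 : 0 <= t * (E - 1) by lra.
have h1 : t * c <= t * (1 - cos (t * u)) by rewrite ler_pM2l//; lra.
have h2 : (t * (E - 1)) * c <= (t * (E - 1)) / 2 by rewrite ler_wpM2l//; lra.
rewrite [leLHS](_ : _ = t * c + t * (E - 1) * c); last by ring.
lra.
Qed.

End trigonometry.

(** * The principal argument in the right half-plane *)

Section principal_argument.
Context {R : realType}.
Implicit Types a r s t x y kappa theta : R.

Lemma carg_polar r theta : 0 < r -> - pi < theta <= pi ->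
  carg ((r * cos theta) +i* (r * sin theta)) = theta.
Proof.
move=> r0 /andP[th1 th2].
have nE : Normc.normc ((r * cos theta) +i* (r * sin theta)) = r.
  by rewrite /= !exprMn -mulrDr cos2Dsin2 mulr1 sqrtr_sqr gtr0_norm.
rewrite /carg ifF; last first.
  by apply/eqP => z0; move: nE; rewrite z0 Normc.normc0 => r0'; rewrite -r0' ltxx in r0.
rewrite nE /= mulrAC divff ?gt_eqF// mul1r pmulr_rge0//.
have [th0|th0] := leP 0 theta.
  by rewrite sin_ge0_pi ?th0// cosK// in_itv/= th0.
rewrite ifF; last first.
  apply/negbTE; rewrite -ltNge -[theta]opprK sinN oppr_lt0 sin_gt0_pi//.
  by rewrite oppr_gt0 th0/= ltrNl.
by rewrite cosKN ?opprK// !ltW.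
Qed.

Lemma cos_atan_gt0 s : 0 < cos (atan s).
Proof. by rewrite cos_gt0_pihalf// atan_gtNpi2 atan_ltpi2. Qed.

Lemma sin_atan s : sin (atan s) = s * cos (atan s).
Proof. by rewrite -[X in X * cos _](atanK s) /tan divfK// gt_eqF// cos_atan_gt0. Qed.

Lemma cos_atan_ge s : (1 + `|s|)^-1 <= cos (atan s).
Proof.
have ns := normr_ge0 s; have ss := sqr_ge0 s.
rewrite cos_atan lef_pV2 ?posrE ?sqrtr_gt0; [|lra|lra].
rewrite -[leRHS]ger0_norm; last lra.
by rewrite -sqrtr_sqr ler_wsqrtr// -(real_normK (num_real s)); nra.
Qed.

Lemma atan_bound_pi s : - pi < atan s <= pi.
Proof.
have := atan_gtNpi2 s; have := atan_ltpi2 s; have := pi_gt0 R.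
by move=> *; apply/andP; split; lra.
Qed.

Lemma carg_atan x y : 0 < x -> carg (x +i* y) = atan (y / x).
Proof.
move=> x0; set s := y / x.
have -> : x +i* y = (x / cos (atan s) * cos (atan s)) +i*
                    (x / cos (atan s) * sin (atan s)).
  have c0 := cos_atan_gt0 s.
  by rewrite sin_atan mulrCA !divfK ?gt_eqF.
by rewrite carg_polar ?atan_bound_pi// divr_gt0// cos_atan_gt0.
Qed.

(** Both arguments lie in [(- pi/2, pi/2)], so their difference needs no
    reduction modulo [2 pi]. *)
Lemma carg_div a t x y : 0 < a -> 0 < x ->
  carg (a%:C * (1 +i* t) / (x +i* y)) = atan t - atan (y / x).
Proof.
move=> a0 x0; set s := y / x.
have ys : y = s * x by rewrite /s divfK ?gt_eqF.
have ct := cos_atan_gt0 t; have cs := cos_atan_gt0 s.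
pose r := a / (x ^+ 2 + y ^+ 2) * (x / (cos (atan t) * cos (atan s))).
have xy0 : 0 < x ^+ 2 + y ^+ 2 by nra.
have -> : a%:C * (1 +i* t) / (x +i* y) =
    (r * cos (atan t - atan s)) +i* (r * sin (atan t - atan s)).
  have e : (cos (atan t) * cos (atan s)) != 0 by rewrite mulf_neq0 ?gt_eqF.
  rewrite cosB sinB !sin_atan /r ys.
  rewrite ys in xy0.
  apply/eqP; rewrite eq_complex /=; apply/andP; split; apply/eqP; field.
    by rewrite !gt_eqF.
  by rewrite !gt_eqF.
apply: carg_polar; first by rewrite mulr_gt0 ?divr_gt0 ?mulr_gt0.
have := atan_gtNpi2 s; have := atan_ltpi2 s; have := atan_gtNpi2 t.
have := atan_ltpi2 t; have := pi_gt0 R.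
by move=> *; apply/andP; split; lra.
Qed.

Lemma sin_le_of_sin_ge0 theta : - pi < theta < pi -> 0 <= sin theta ->
  sin theta <= theta.
Proof.
move=> /andP[t1 t2] s0.
have [t0|t0] := leP 0 theta.
  exact: le_trans (ler_norm _) (normr_sin_le t0).
have : 0 < sin (- theta) by rewrite sin_gt0_pi//; apply/andP; split; lra.
by rewrite sinN; lra.
Qed.

(** The sine of the difference of the arguments of [1 + i t] and [x + i y] is
    [(t x - y) / (|1 + i t| |x + i y|)]; as it is nonnegative here, it is a lower
    bound for that difference. *)
Lemma atan_sub_ge t x y kappa : 0 <= t -> 0 < x -> 0 <= kappa ->
  kappa * (x + `|y|) <= t * x - y ->
  kappa / (1 + t) <= atan t - atan (y / x).
Proof.
move=> t0 x0 k0 kle; set s := y / x.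
have ys : y = s * x by rewrite /s divfK ?gt_eqF.
have sE : sin (atan t - atan s) = (t - s) * (cos (atan t) * cos (atan s)).
  by rewrite sinB !sin_atan; ring.
have kts : kappa * (1 + `|s|) <= t - s.
  rewrite -(ler_pM2r x0); move: kle; rewrite ys normrM (gtr0_norm x0); lra.
have ns := normr_ge0 s.
have kk : kappa / (1 + t) <= sin (atan t - atan s).
  rewrite sE; apply: (@le_trans _ _ (kappa * (1 + `|s|) *
      ((1 + `|t|)^-1 * (1 + `|s|)^-1))).
    rewrite (ger0_norm t0) le_eqVlt; apply/orP; left; apply/eqP; field.
    by rewrite !gt_eqF//; lra.
  have it0 : 0 <= (1 + `|t|)^-1 by rewrite invr_ge0 addr_ge0.
  have is0 : 0 <= (1 + `|s|)^-1 by rewrite invr_ge0 addr_ge0.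
  apply: ler_pM => //; [by rewrite mulr_ge0 ?addr_ge0|].
  by apply: ler_pM; rewrite ?cos_atan_ge.
have k1 : 0 <= kappa / (1 + t) by rewrite divr_ge0//; lra.
apply: (le_trans kk); apply: sin_le_of_sin_ge0; last exact: le_trans kk.
have := atan_gtNpi2 s; have := atan_ltpi2 s; have := atan_gtNpi2 t.
have := atan_ltpi2 t; have := pi_gt0 R.
by move=> *; apply/andP; split; lra.
Qed.

End principal_argument.

(** * The integrated tail of a Levy measure *)

Section levy_measure_theory.
Context {R : realType} (mu : {measure set (measurableTypeR R) -> \bar R}).
Hypothesis hmu : levy_measure mu.
Implicit Types x y : R.

Local Notation D := (`]0%R, +oo[%classic : set (measurableTypeR R)).

Let mD : measurable D. Proof. exact: measurable_itv. Qed.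

Lemma measurable_min (c : R) (E : set (measurableTypeR R)) :
  measurable_fun E (fun y : measurableTypeR R => Num.min y c).
Proof. exact: measurable_minr. Qed.

Lemma levy_tail_lty y : 0 < y -> (levy_tail mu y < +oo)%E.
Proof.
move=> y0; have m0 : 0 < Num.min y 1 by rewrite lt_min y0/=.
rewrite -(@lte_pmul2l _ (Num.min y 1)%:E) ?lte_fin// gt0_muley ?lte_fin//.
apply: le_lt_trans hmu.
rewrite /levy_tail -integral_cst//.
apply: (@le_trans _ _ (\int[mu]_(u in `]y, +oo[) (Num.min u 1)%:E)%E).
  apply: ge0_le_integral => //.
  - by move=> u _; rewrite lee_fin ltW.
  - by apply/measurable_EFinP; exact: measurable_min.
  - move=> u /=; rewrite in_itv/= andbT lee_fin => yu.
    by rewrite le_min !ge_min (ltW yu) lexx orbT.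
apply: ge0_subset_integral => //.
- by apply/measurable_EFinP; exact: measurable_min.
- by move=> u /=; rewrite in_itv/= andbT lee_fin le_min => /ltW ->/=.
- by move=> u /=; rewrite !in_itv/= !andbT; exact: lt_trans.
Qed.

Lemma levy_tail_fin_num y : 0 < y -> levy_tail mu y \is a fin_num.
Proof. by move=> y0; rewrite ge0_fin_numE ?measure_ge0// levy_tail_lty. Qed.

Lemma levy_integrable_min1 :
  mu.-integrable D (fun y : measurableTypeR R => (Num.min y 1)%:E).
Proof.
apply/integrableP; split; first by apply/measurable_EFinP; exact: measurable_min.
rewrite (_ : (\int[mu]_(x in D) _)%E =
  (\int[mu]_(y in D) (Num.min y 1)%:E)%E) //.
apply: eq_integral => y; rewrite inE/= in_itv/= andbT => y0.
by rewrite ger0_norm// le_min ltW/=.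
Qed.

Lemma levy_integrable (f : measurableTypeR R -> R) (K x : R) :
  0 <= K -> 0 < x -> measurable_fun D f ->
  (forall y, 0 < y -> `|f y| <= K * Num.min y x) ->
  mu.-integrable D (EFin \o f).
Proof.
move=> K0 x0 mf fK; pose L := K * Num.max 1 x.
apply: (le_integrable mD (g := fun y => L%:E * (Num.min y 1)%:E)%E).
- exact/measurable_EFinP.
- move=> y /=; rewrite in_itv/= andbT => y0; rewrite lee_fin.
  rewrite (le_trans (fK _ y0))// (le_trans _ (ler_norm _))// /L -mulrA.
  rewrite ler_wpM2l//.
  have : 1 <= Num.max 1 x /\ x <= Num.max 1 x by rewrite !le_max !lexx orbT.
  set M := Num.max _ _; case=> M1 xM.
  have [y1|y1] := leP y 1; last by rewrite mulr1 ge_min xM orbT.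
  by rewrite ge_min ler_peMl// ltW.
- exact: (integrableZl mD L levy_integrable_min1).
Qed.

Lemma levy_integrable_min x : 0 < x ->
  mu.-integrable D (EFin \o (fun y : measurableTypeR R => Num.min y x)).
Proof.
move=> x0; apply: (@levy_integrable _ 1 x) => //; first exact: measurable_min.
by move=> y y0; rewrite mul1r ger0_norm// le_min !ltW.
Qed.

Lemma levy_integrable_indic x (E : set (measurableTypeR R)) : 0 < x ->
  measurable E -> E `<=` `]x, +oo[ -> mu.-integrable D (EFin \o \1_E).
Proof.
move=> x0 mE Ex; apply: (@levy_integrable _ x^-1 x) => //.
  by rewrite invr_ge0 ltW.
move=> y y0; rewrite indicE; case: (boolP (y \in E)) => [|_].
  rewrite inE => /Ex/=; rewrite in_itv/= andbT => xy.
  by rewrite normr1 min_r ?(ltW xy)// mulVf// gt_eqF.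
by rewrite normr0 mulr_ge0 ?invr_ge0 ?le_min// !ltW.
Qed.

Lemma Rintegral_levy_indic x (E : set (measurableTypeR R)) : 0 < x ->
  measurable E -> E `<=` `]x, +oo[ ->
  \int[mu]_(y in D) \1_E y = fine (mu E).
Proof.
move=> x0 mE Ex; rewrite /Rintegral integral_indic// setIidl// => y /Ex/=.
by rewrite !in_itv/= !andbT; exact: lt_trans.
Qed.

(** The measure [mu] may be wild on the negative half-line and at [0]; only its
    restriction to the positive half-line is known to be sigma-finite, as Tonelli's theorem
    requires. *)
Definition levy_restr & levy_measure mu := mrestr mu mD.

HB.instance Definition _ h := Measure.on (levy_restr h).

Lemma levy_restr_sigma_finite h : sigma_finite setT (levy_restr h).
Proof.
exists (fun n => (`]-oo, 0%R] `|` `]n.+1%:R^-1%R, +oo[)%classic).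
  apply/seteqP; split=> // y _ /=.
  have [y0|y0] := leP y 0; first by exists 0%N => //; left; rewrite /= in_itv.
  exists (Num.truncn y^-1) => //; right; rewrite /= in_itv/= andbT.
  rewrite invf_plt ?posrE//.
  exact: Num.Theory.truncnS_gt.
move=> n; split; first by apply: measurableU; exact: measurable_itv.
apply: (@le_lt_trans _ _ (levy_tail mu n.+1%:R^-1)); last exact: levy_tail_lty.
rewrite /levy_restr /mrestr; apply: le_measure; rewrite ?inE//.
- apply: measurableI => //.
  by apply: measurableU; exact: measurable_itv.
- move=> y [[|]] /=; rewrite !in_itv/= !andbT// => h1 h2.
  by rewrite ltNge h1 in h2.
Qed.

HB.instance Definition _ h := @Measure_isSigmaFinite.Build _ _ _ (levy_restr h)
  (levy_restr_sigma_finite h).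

(** Tonelli's theorem on [{(y, s) | 0 < s <= x, s < y}]. *)
Lemma int_levy_tailE x : 0 < x ->
  int_levy_tail mu x = (\int[mu]_(y in D) (Num.min y x)%:E)%E.
Proof.
move=> x0; pose m1 := levy_restr hmu.
pose A : set (measurableTypeR R * measurableTypeR R) :=
  [set p | (0 < p.2 <= x) && (p.2 < p.1)].
have mA : measurable A.
  have mb : measurable_fun setT
      (fun p : measurableTypeR R * measurableTypeR R =>
        (0 < p.2 <= x) && (p.2 < p.1)).
    apply: measurable_and; first apply: measurable_and.
    - exact: measurable_fun_ltr.
    - exact: measurable_fun_ler.
    - exact: measurable_fun_ltr.
  have := mb measurableT [set true] Logic.I; rewrite setTI.
  by congr measurable; apply/seteqP; split=> p /=.
have AE y s : ((y, s) \in A) = (0 < s <= x) && (s < y).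
  by apply/idP/idP; rewrite inE.
have := @indic_fubini_tonelli _ _ _ _ _ m1 (@lebesgue_measure R) A mA.
rewrite indic_fubini_tonelli_FE// indic_fubini_tonelli_GE// => tonelli.
rewrite /int_levy_tail integral_mkcond.
transitivity (\int[lebesgue_measure]_s (m1 \o ysection A) s)%E.
  apply: eq_integral => s _; rewrite patchE /=; case: ifPn.
    rewrite inE/= in_itv/= => /andP[s0 sx]; rewrite /m1 /levy_restr /mrestr.
    congr (mu _); apply/seteqP; split=> y /=.
      rewrite in_itv/= andbT => sy; split.
        by rewrite /ysection /= AE s0 sx sy.
      by rewrite in_itv/= andbT (lt_trans s0).
    by case; rewrite /ysection /= AE => /andP[_ sy] _; rewrite in_itv/= sy.
  rewrite notin_setE/= in_itv/= => /negP sx.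
  rewrite [ysection A s](_ : _ = set0); first by rewrite /m1 measure0.
  by apply/seteqP; split=> // y; rewrite /ysection /= AE (negbTE sx).
rewrite -tonelli [LHS](_ : _ = \int[m1]_(y in D) (Num.min y x)%:E)%E; last first.
  rewrite [RHS]integral_mkcond; apply: eq_integral => y _; rewrite patchE /=.
  case: ifPn.
    rewrite inE/= in_itv/= andbT => y0.
    rewrite [xsection A y](_ : _ =
        if y <= x then `]0, y[%classic else `]0, x]%classic).
      case: ifPn => yx;
        rewrite lebesgue_measure_itv/= lte_fin ?x0 ?y0 oppr0 adde0.
        by rewrite min_l.
      by rewrite min_r// ltW// ltNge.
    apply/seteqP; split=> s; rewrite /xsection /= AE.
      by case: ifPn => yx /andP[/andP[s0 sx] sy]; rewrite /= in_itv/= s0 ?sy ?sx.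
    case: ifPn => yx; rewrite /= in_itv/= => /andP[s0 sx]; rewrite s0/=.
      by rewrite sx (ltW (lt_le_trans sx yx)).
    by rewrite sx/= (le_lt_trans sx)// ltNge.
  rewrite notin_setE/= in_itv/= andbT => /negP y0.
  rewrite [xsection A y](_ : _ = set0) ?measure0//.
  apply/seteqP; split=> // s; rewrite /xsection /= AE.
  move=> /andP[/andP[s0 _] sy].
  by move/negP : y0; rewrite (lt_trans s0 sy).
apply: eq_measure_integral => E mE ED.
by rewrite /m1 /= /levy_restr /mrestr setIidl.
Qed.

(** By [int_levy_tailE] this is the integrated tail; as an integral against [mu] it
    compares directly with the Laplace exponent. *)
Definition truncated_mean x : R := \int[mu]_(y in D) Num.min y x.

Definition tail y : R := fine (levy_tail mu y).

Lemma tail_ge0 y : 0 <= tail y. Proof. exact: fine_ge0. Qed.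

Lemma int_levy_tail_fin x : 0 < x ->
  int_levy_tail mu x = (truncated_mean x)%:E.
Proof.
move=> x0; rewrite int_levy_tailE// fineK//.
exact: (integrable_fin_num mD (levy_integrable_min x0)).
Qed.

Lemma truncated_mean_ge0 x : 0 < x -> 0 <= truncated_mean x.
Proof.
move=> x0; apply: Rintegral_ge0 => y /=; rewrite in_itv/= andbT => y0.
by rewrite le_min !ltW.
Qed.

(** Pointwise, [min (y, 2 x)] exceeds [min (y, x)] by at most [x], and only where
    [y > x]. *)
Lemma truncated_mean_double x : 0 < x ->
  truncated_mean (2 * x) <= truncated_mean x + x * tail x.
Proof.
move=> x0; have x20 : 0 < 2 * x by rewrite mulr_gt0.
have ix := @levy_integrable_indic x _ x0 (measurable_itv `]x, +oo[)
  (@subset_refl _ _).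
have iy := levy_integrable_min x0.
rewrite /tail /levy_tail -(@Rintegral_levy_indic x)// /truncated_mean.
rewrite -(RintegralZl x mD ix) -RintegralD//; last exact: (integrableZl mD x ix).
apply: le_Rintegral => //.
- exact: levy_integrable_min.
- exact: (integrableD mD iy (integrableZl mD x ix)).
move=> y /=; rewrite in_itv/= andbT => y0; rewrite indicE mem_setE in_itv/= andbT.
case: (ltP x y) => xy; last by rewrite mulr0 addr0 min_l//; lra.
by rewrite mulr1 ge_min; apply/orP; right; lra.
Qed.

Lemma tail_window x : 0 < x ->
  \int[mu]_(y in D) \1_(`]x, 2 * x]%classic) y = tail x - tail (2 * x).
Proof.
move=> x0; have x20 : 0 < 2 * x by rewrite mulr_gt0.
rewrite (@Rintegral_levy_indic x)//; last first.
  by move=> y /=; rewrite !in_itv/= => /andP[->].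
have -> : tail x = fine (mu `]x, 2 * x]%classic) + tail (2 * x).
  rewrite /tail /levy_tail -fineD; last 2 first.
  - rewrite ge0_fin_numE//; apply: le_lt_trans (levy_tail_lty x0).
    apply: le_measure; rewrite ?inE//.
    by move=> y /=; rewrite !in_itv/= => /andP[->].
  - exact: levy_tail_fin_num.
  rewrite -measureU//; last first.
    apply/seteqP; split=> // y /=; rewrite !in_itv/= => -[/andP[_ h1]].
    by rewrite andbT ltNge h1.
  congr (fine (mu _)); apply/seteqP; split=> y /=; rewrite !in_itv/= !andbT.
    by move=> xy; case: (leP y (2 * x)) => h; [left; rewrite xy|right].
  by case=> [/andP[]//|]; apply: lt_trans; lra.
by rewrite addrK.
Qed.

End levy_measure_theory.

(** * Reading the two asymptotic hypotheses *)

Section asymptotics.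
Context {R : realType}.
Implicit Types f : R -> \bar R.

Lemma limf_einf_gt1_near f : (1 < limf_einf f 0%R^'+)%E ->
  exists b x0 : R, [/\ 1 < b, 0 < x0 &
    forall x, 0 < x < x0 -> (b%:E <= f x)%E].
Proof.
rewrite limf_einfE => /ereal_sup_gt[_ [V FV <-]] inf1.
have [e /= e0 eV] := FV.
have xV x : 0 < x < e -> V x.
  move=> /andP[x0 xe]; apply: eV => //=; rewrite sub0r normrN gtr0_norm//.
have [b b1 binf] : exists2 b : R, 1 < b & (b%:E <= ereal_inf (f @` V))%E.
  case: (ereal_inf _) inf1 => [r| |]//.
    by rewrite lte_fin => r1; exists r.
  by move=> _; exists 2; rewrite ?leey// ltr1n.
exists b, e; split=> // x /xV Vx; apply: (le_trans binf).
by apply: ereal_inf_lbound; exists x.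
Qed.

Lemma limf_esup_lt1_near f : (forall x, 0 <= f x)%E ->
  (limf_esup f 0%R^'+ < 1)%E ->
  exists r x0 : R, [/\ r < 1, 0 < x0 &
    forall x, 0 < x < x0 -> (f x <= r%:E)%E].
Proof.
move=> f0; rewrite limf_esupE => /ereal_inf_lt[_ [V FV <-]] sup1.
have [e /= e0 eV] := FV.
have xV x : 0 < x < e -> V x.
  move=> /andP[x0 xe]; apply: eV => //=; rewrite sub0r normrN gtr0_norm//.
have [r r1 supr] : exists2 r : R, r < 1 & (ereal_sup (f @` V) <= r%:E)%E.
  case: (ereal_sup _) sup1 => [r| |]//.
    by rewrite lte_fin => r1; exists r.
  by move=> _; exists 0; rewrite ?leNye// ltr01.
exists r, e; split=> // x /xV Vx; apply: le_trans supr.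
by apply: ereal_sup_ubound; exists x.
Qed.

Variables (mu : {measure set (measurableTypeR R) -> \bar R}).
Hypothesis hmu : levy_measure mu.

(** With [J] the truncated mean and [T] the tail, positive increase
    [b J(x) <= J(2 x)], where [b > 1], and [J(2 x) <= J(x) + x T(x)] give
    [J(x) <= x T(x) / (b - 1)]. If [T(x)] were zero, so would be [J(x)], then
    [J(2 x)], and then their quotient by the convention [0 / 0 = 0]. *)
Lemma positive_increase_truncated_mean : positive_increase mu ->
  exists K x0 : R, [/\ 0 < K, 0 < x0 &
    forall x, 0 < x < x0 ->
      0 < tail mu x /\ truncated_mean mu x <= K * (x * tail mu x)].
Proof.
move=> /limf_einf_gt1_near[b [x0 [b1 x00 bx]]].
exists (b - 1)^-1, x0; split => //; first by rewrite invr_gt0 subr_gt0.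
move=> x xx0; have := bx _ xx0; case/andP: xx0 => xgt0 _.
rewrite !int_levy_tail_fin//; last by rewrite mulr_gt0.
have J0 := truncated_mean_ge0 mu xgt0; have T0 := tail_ge0 mu x.
have J20 : 0 <= truncated_mean mu (2 * x).
  by rewrite truncated_mean_ge0// mulr_gt0.
have dbl := truncated_mean_double hmu xgt0.
rewrite inver; case: ifPn => [/eqP J00|Jn0].
  have [Jz|Jnz] := eqVneq (truncated_mean mu (2 * x)) 0.
    by rewrite Jz mul0e lee_fin leNgt (lt_trans ltr01 b1).
  move=> _; have J2 : 0 < truncated_mean mu (2 * x) by rewrite lt_def Jnz.
  have xT : 0 < x * tail mu x.
    by move: dbl; rewrite J00 add0r; exact: lt_le_trans.
  rewrite J00; split; first by rewrite -(pmulr_rgt0 _ xgt0).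
  by rewrite mulr_ge0 ?(ltW xT)// invr_ge0; lra.
have Jp : 0 < truncated_mean mu x by rewrite lt_def Jn0.
rewrite -EFinM lee_fin ler_pdivlMr// => bJ.
have h : (b - 1) * truncated_mean mu x <= x * tail mu x by lra.
split; last by rewrite mulrC ler_pdivlMr ?subr_gt0// mulrC.
rewrite -(pmulr_rgt0 _ xgt0); apply: lt_le_trans h.
by rewrite mulr_gt0// subr_gt0.
Qed.

Lemma levy_tail_ratio_lt1_tail : levy_tail_ratio_lt1 mu ->
  exists r x0 : R, [/\ r < 1, 0 < x0 &
    forall x, 0 < x < x0 -> tail mu (2 * x) <= r * tail mu x].
Proof.
move=> /limf_esup_lt1_near[x|r [x0 [r1 x00 rx]]].
  by rewrite mule_ge0// inve_ge0.
exists r, x0; split=> // x xx0; have := rx _ xx0; case/andP: xx0 => xgt0 _.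
have x20 : 0 < 2 * x by rewrite mulr_gt0.
rewrite -(fineK (levy_tail_fin_num hmu xgt0)).
rewrite -(fineK (levy_tail_fin_num hmu x20)).
rewrite -/(tail mu x) -/(tail mu (2 * x)).
have T2 : tail mu (2 * x) <= tail mu x.
  rewrite fine_le ?levy_tail_fin_num//; apply: le_measure; rewrite ?inE//.
  by move=> y /=; rewrite !in_itv/= !andbT; apply: lt_trans; lra.
have := tail_ge0 mu x; have := tail_ge0 mu (2 * x).
rewrite inver; case: ifPn => [/eqP T0 T20 _ _|Tn0 _ Tge0].
  by move: T2; rewrite T0 mulr0.
have Tp : 0 < tail mu x by rewrite lt_def Tn0.
by rewrite -EFinM lee_fin ler_pdivrMr.
Qed.

End asymptotics.

(** * Laplace exponents on vertical half-lines *)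

Section laplace_exponent.
Context {R : realType} (mu : {measure set (measurableTypeR R) -> \bar R}).
Hypothesis hmu : levy_measure mu.
Implicit Types a eta q t x y : R.

Local Notation D := (`]0%R, +oo[%classic : set (measurableTypeR R)).

Let mD : measurable D. Proof. exact: measurable_itv. Qed.

Definition re_exponent q a t := q + \int[mu]_(y in D) re_kernel t (a * y).
Definition im_exponent a t := \int[mu]_(y in D) im_kernel t (a * y).

Lemma laplace_exponent_kernels q phi a t :
  is_laplace_exponent q 0 mu phi -> 0 < a ->
  phi (a%:C * (1 +i* t)) = re_exponent q a t +i* im_exponent a t.
Proof.
move=> [_ _ _ phiE] a0; rewrite phiE; last by rewrite /= mul0r subr0 mulr1 ltW.
rewrite mul0r addr0 /re_exponent /im_exponent /cintegral.
have reE y :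
    complex.Re (1 - cexp (- (a%:C * (1 +i* t)) * y%:C)) = re_kernel t (a * y).
  by rewrite /re_kernel -[cos (t * _)]cosN /=; congr (1 - expR _ * cos _); ring.
have imE y :
    complex.Im (1 - cexp (- (a%:C * (1 +i* t)) * y%:C)) = im_kernel t (a * y).
  rewrite /im_kernel /= sub0r -mulrN -sinN.
  by congr (expR _ * sin _); ring.
under eq_Rintegral => y _ do rewrite reE.
under [X in _ + (_ +i* X)]eq_Rintegral => y _ do rewrite imE.
by apply/eqP; rewrite eq_complex /= add0r !eqxx.
Qed.

Lemma scaled_min a t y : 0 < a -> 0 < t ->
  Num.min (t * (a * y)) 2 = a * t * Num.min y (2 / (a * t)).
Proof.
move=> a0 t0; rewrite minr_pMr ?mulr_ge0 ?ltW//; congr Num.min; first ring.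
by field; rewrite !gt_eqF.
Qed.

Lemma measurable_re_kernel a t :
  measurable_fun D (fun y : measurableTypeR R => re_kernel t (a * y)).
Proof.
apply: measurable_funTS; apply: continuous_measurable_fun => y.
apply: cvgB; first exact: cvg_cst.
apply: cvgM; apply: continuous_comp;
  try exact: continuous_expR; try exact: continuous_cos.
  by apply: cvgN; apply: cvgM; [exact: cvg_cst|exact: cvg_id].
by apply: cvgM; [exact: cvg_cst|apply: cvgM; [exact: cvg_cst|exact: cvg_id]].
Qed.

Lemma measurable_im_kernel a t :
  measurable_fun D (fun y : measurableTypeR R => im_kernel t (a * y)).
Proof.
apply: measurable_funTS; apply: continuous_measurable_fun => y.
apply: cvgM; apply: continuous_comp;
  try exact: continuous_expR; try exact: continuous_sin.
  by apply: cvgN; apply: cvgM; [exact: cvg_cst|exact: cvg_id].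
by apply: cvgM; [exact: cvg_cst|apply: cvgM; [exact: cvg_cst|exact: cvg_id]].
Qed.

Lemma integrable_re_kernel a t : 0 < a -> 0 < t ->
  mu.-integrable D (EFin \o (fun y => re_kernel t (a * y))).
Proof.
move=> a0 t0; have at0 : 0 < a * t by rewrite mulr_gt0.
apply: (levy_integrable hmu (K := (1 + t^-1) * (a * t)) (x := 2 / (a * t))).
- by rewrite mulr_ge0 ?addr_ge0 ?invr_ge0// ltW.
- by rewrite divr_gt0.
- exact: measurable_re_kernel.
move=> y y0; rewrite -mulrA -scaled_min//; apply: re_kernel_le => //.
by rewrite mulr_ge0// ltW.
Qed.

Lemma integrable_im_kernel a t : 0 < a -> 0 < t ->
  mu.-integrable D (EFin \o (fun y => im_kernel t (a * y))).
Proof.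
move=> a0 t0; have at0 : 0 < a * t by rewrite mulr_gt0.
apply: (levy_integrable hmu (K := a * t) (x := 2 / (a * t))).
- exact: ltW.
- by rewrite divr_gt0.
- exact: measurable_im_kernel.
by move=> y y0; rewrite -scaled_min// im_kernel_le// ?mulr_ge0// ltW.
Qed.

(** Since [|1 - exp (- z y)|] is at most a multiple of [min (|z| y, 1)], the exponent
    at [z] is controlled by [|z|] times the truncated mean at the scale [1 / |z|];
    for [t >= eta] the modulus [|z|] is comparable to [a t]. *)
Lemma exponent_le q eta a t : 0 <= q -> 0 < a -> 0 < eta -> eta <= t ->
  `|re_exponent q a t| + `|im_exponent a t| <=
  q + (2 + eta^-1) * (a * t * truncated_mean mu (2 / (a * t))).
Proof.
move=> q0 a0 eta0 etat; have t0 : 0 < t by exact: lt_le_trans etat.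
have at0 : 0 < a * t by rewrite mulr_gt0.
set x := 2 / (a * t).
have x0 : 0 < x by rewrite divr_gt0.
have ix := levy_integrable_min hmu x0.
have ire := integrable_re_kernel a0 t0.
have iim := integrable_im_kernel a0 t0.
have re : `|\int[mu]_(y in D) re_kernel t (a * y)| <=
    (1 + eta^-1) * (a * t) * truncated_mean mu x.
  apply: (le_trans (le_normr_Rintegral mD ire)).
  rewrite /truncated_mean -RintegralZl//; apply: le_Rintegral => //.
  - exact: integrable_norm.
  - exact: (integrableZl mD _ ix).
  move=> y /=; rewrite in_itv/= andbT => y0; rewrite -mulrA -scaled_min//.
  by apply: re_kernel_le => //; rewrite mulr_ge0// ltW.
have im : `|im_exponent a t| <= a * t * truncated_mean mu x.
  apply: (le_trans (le_normr_Rintegral mD iim)).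
  rewrite /truncated_mean -RintegralZl//; apply: le_Rintegral => //.
  - exact: integrable_norm.
  - exact: (integrableZl mD _ ix).
  move=> y /=; rewrite in_itv/= andbT => y0; rewrite -scaled_min//.
  by apply: im_kernel_le; rewrite ?mulr_ge0// ltW.
have := ler_normD q (\int[mu]_(y in D) re_kernel t (a * y)).
rewrite -/(re_exponent q a t) (ger0_norm q0); lra.
Qed.

(** The real kernel is at least [1 - exp(- a x)] on the jumps larger than [x]. *)
Lemma re_exponent_gt0 q a t x : 0 <= q -> 0 < a -> 0 < t -> 0 < x ->
  0 < tail mu x -> 0 < re_exponent q a t.
Proof.
move=> q0 a0 t0 x0 Tx; apply: (@lt_le_trans _ _ ((1 - expR (- (a * x))) * tail mu x)).
  by rewrite mulr_gt0// subr_gt0 -expR0 ltr_expR oppr_lt0 mulr_gt0.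
have ix := levy_integrable_indic hmu x0 (measurable_itv `]x, +oo[)
  (@subset_refl _ _).
rewrite -[leLHS]add0r lerD//.
rewrite /tail /levy_tail -(@Rintegral_levy_indic _ mu x)// -RintegralZl//.
apply: le_Rintegral => //.
- exact: (integrableZl mD _ ix).
- exact: integrable_re_kernel.
move=> y /=; rewrite in_itv/= andbT => y0.
have ay : 0 <= a * y by rewrite mulr_ge0// ltW.
apply: le_trans (re_kernel_ge t ay).
rewrite indicE mem_setE in_itv/= andbT; case: (ltP x y) => xy.
  by rewrite mulr1 lerD2l lerN2 ler_expR lerN2 ler_pM2l// ltW.
by rewrite mulr0 subr_ge0 -expR0 ler_expR oppr_le0.
Qed.

Lemma arg_exponentE q a t : 0 < a -> 0 < t ->
  t * re_exponent q a t - im_exponent a t =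
  t * q + \int[mu]_(y in D) arg_kernel t (a * y).
Proof.
move=> a0 t0; have ire := integrable_re_kernel a0 t0.
have iim := integrable_im_kernel a0 t0.
rewrite /re_exponent /im_exponent mulrDr -addrA; congr (_ + _).
by rewrite -RintegralZl// -RintegralB//; exact: (integrableZl mD _ ire).
Qed.

Lemma integrable_arg_kernel a t : 0 < a -> 0 < t ->
  mu.-integrable D (EFin \o (fun y => arg_kernel t (a * y))).
Proof.
move=> a0 t0; exact: (integrableB mD
  (integrableZl mD t (integrable_re_kernel a0 t0)) (integrable_im_kernel a0 t0)).
Qed.

(** The kernel is nonnegative everywhere and bounded below on the jumps larger than
    [2 / (a t)], so these alone give a lower bound. *)
Lemma arg_exponent_ge q eta a t : 0 < a -> 0 < eta -> eta <= t ->
  t * q + eta / (2 * (1 + eta)) * tail mu (2 / (a * t)) <=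
  t * re_exponent q a t - im_exponent a t.
Proof.
move=> a0 eta0 etat; have t0 : 0 < t by exact: lt_le_trans etat.
have at0 : 0 < a * t by rewrite mulr_gt0.
set x := 2 / (a * t); have x0 : 0 < x by rewrite divr_gt0.
have ix := levy_integrable_indic hmu x0 (measurable_itv `]x, +oo[)
  (@subset_refl _ _).
rewrite arg_exponentE// lerD2l /tail /levy_tail -(@Rintegral_levy_indic _ mu x)//.
rewrite -RintegralZl//; apply: le_Rintegral => //.
- exact: (integrableZl mD _ ix).
- exact: integrable_arg_kernel.
move=> y /=; rewrite in_itv/= andbT => y0.
have ay : 0 <= a * y by rewrite mulr_ge0// ltW.
rewrite indicE mem_setE in_itv/= andbT; case: (ltP x y) => xy.
  rewrite mulr1; apply: arg_kernel_ge => //.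
  by move: xy; rewrite /x ltr_pdivrMr// => /ltW; lra.
by rewrite mulr0 arg_kernel_ge0// ltW.
Qed.

(** Keeping only the jumps between [2 / (a t)] and [4 / (a t)], on which the kernel is
    of order [t], gains a factor [t] over [arg_exponent_ge]. *)
Lemma arg_exponent_window q a t : 0 < a -> 0 < t ->
  t * q + t * Num.min (1 / 2) (1 + cos 2) *
    (tail mu (2 / (a * t)) - tail mu (2 * (2 / (a * t)))) <=
  t * re_exponent q a t - im_exponent a t.
Proof.
move=> a0 t0; have at0 : 0 < a * t by rewrite mulr_gt0.
set x := 2 / (a * t); have x0 : 0 < x by rewrite divr_gt0.
have sx : `]x, 2 * x]%classic `<=` (`]x, +oo[%classic : set R).
  by move=> y /=; rewrite !in_itv/= => /andP[->].
have ix := levy_integrable_indic hmu x0 (measurable_itv `]x, 2 * x]) sx.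
rewrite arg_exponentE// lerD2l -(tail_window hmu x0).
rewrite -RintegralZl//; apply: le_Rintegral => //.
- exact: (integrableZl mD _ ix).
- exact: integrable_arg_kernel.
move=> y /=; rewrite in_itv/= andbT => y0.
have ay : 0 <= a * y by rewrite mulr_ge0// ltW.
rewrite indicE mem_setE in_itv/=; case: (boolP (x < y <= 2 * x)) => [/andP[xy yx]|_].
  rewrite mulr1; apply: arg_kernel_window => //.
  move: xy yx; rewrite /x ltr_pdivrMr// mulrA ler_pdivlMr// => /ltW h1 h2.
  by apply/andP; split; lra.
by rewrite mulr0 arg_kernel_ge0// ltW.
Qed.

End laplace_exponent.

(** * Lower bounds for the argument *)

Section argument_gap.
Context {R : realType}.
Implicit Types a eta t x y kappa : R.

Lemma carg_gap a t x y kappa : 0 < a -> 0 <= t -> 0 < x -> 0 <= kappa ->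
  kappa * (x + `|y|) <= t * x - y ->
  let z := a%:C * (1 +i* t) in let w := x +i* y in
  [/\ carg z - carg w = carg (z / w), kappa / (1 + t) <= carg (z / w) &
      carg w <= atan t - kappa / (1 + t)].
Proof.
move=> a0 t0 x0 k0 kle z w.
have gap := atan_sub_ge t0 x0 k0 kle.
have zE : carg z = atan t.
  rewrite /z (_ : _ * _ = a +i* (a * t)); last first.
    by apply/eqP; rewrite eq_complex /= !(mul0r, mulr1, subr0, addr0) !eqxx.
  by rewrite carg_atan// mulrC mulKf// gt_eqF.
by rewrite /w carg_div// zE carg_atan//; split => //; lra.
Qed.

Lemma ratio_one_add_ge eta t : 0 < eta -> eta <= t ->
  eta / (1 + eta) <= t / (1 + t).
Proof.
move=> eta0 etat; rewrite ler_pdivrMr; last lra.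
by rewrite mulrAC ler_pdivlMr; lra.
Qed.

End argument_gap.

Theorem theorem5p3 (R : realType) (q d : R)
    (mu : {measure set (measurableTypeR R) -> \bar R})
    (phi : R[i] -> R[i])
    (hphi : is_laplace_exponent q d mu phi)
    (phi_neq0 : exists2 z : R[i], 0 <= complex.Re z & phi z != 0)
    (driftless : d = 0)
    (mu_pos_incr : positive_increase mu) :
  (forall eta : R, 0 < eta ->
    exists a_eta C_eta : R, [/\ 0 < a_eta, 0 < C_eta &
      forall t a : R, eta <= t -> a_eta <= a ->
        let z := a%:C * (1 +i* t) in
        [/\ carg z - carg (phi z) = carg (phi_star phi z),
            C_eta / t <= carg (phi_star phi z) &
            carg (phi z) <= atan t - C_eta / t]]) /\
  (levy_tail_ratio_lt1 mu ->
   forall eta : R, 0 < eta ->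
    exists a_eta' eps_eta : R, [/\ 0 < a_eta', 0 < eps_eta &
      forall t a : R, eta <= t -> a_eta' <= a ->
        let z := a%:C * (1 +i* t) in
        [/\ carg z - carg (phi z) = carg (phi_star phi z),
            eps_eta <= carg (phi_star phi z) &
            carg (phi z) <= atan t - eps_eta]]).
Proof.
case: (hphi) => q0 _ hmu _; rewrite driftless in hphi.
have [K [x0 [K0 x00 Jle]]] := positive_increase_truncated_mean hmu mu_pos_incr.
(* With [x = 2 / (a t)] and [a >= 4 / (x1 eta)] one has [0 < x < x1]. *)
have scale_lt (eta t a x1 : R) :
    0 < eta -> eta <= t -> 0 < x1 -> 4 / (x1 * eta) <= a ->
    [/\ 0 < a, 0 < t & 0 < 2 / (a * t) < x1].
  move=> eta0 etat x10 ha.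
  have xe0 : 0 < x1 * eta by rewrite mulr_gt0.
  have a0 : 0 < a by apply: lt_le_trans ha; rewrite divr_gt0.
  have t0 : 0 < t by exact: lt_le_trans etat.
  have at0 : 0 < a * t by rewrite mulr_gt0.
  split=> //; rewrite divr_gt0//= ltr_pdivrMr//.
  move: ha; rewrite ler_pdivrMr// => ha.
  have : a * (x1 * eta) <= a * (x1 * t) by rewrite !ler_pM2l.
  lra.
have norm_le (eta t a : R) :
    0 < eta -> eta <= t -> 0 < a -> 0 < 2 / (a * t) < x0 ->
    0 < re_exponent mu q a t /\
    re_exponent mu q a t + `|im_exponent mu a t| <=
      q + 2 * (2 + eta^-1) * K * tail mu (2 / (a * t)).
  move=> eta0 etat a0 xx0; have [T0 JT] := Jle _ xx0.
  have t0 : 0 < t by exact: lt_le_trans etat.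
  have [x_gt0 _] := andP xx0.
  have X0 := re_exponent_gt0 hmu q0 a0 t0 x_gt0 T0.
  split=> //; rewrite -[re_exponent _ _ _ _]gtr0_norm//.
  apply: le_trans (exponent_le hmu q0 a0 eta0 etat) _; rewrite lerD2l.
  have at0 : 0 < a * t by rewrite mulr_gt0.
  have e : a * t * truncated_mean mu (2 / (a * t)) <=
      2 * (K * tail mu (2 / (a * t))).
    rewrite -ler_pdivlMl//; apply: (le_trans JT).
    rewrite le_eqVlt; apply/orP; left; apply/eqP.
    by field; rewrite !gt_eqF.
  apply: le_trans (ler_wpM2l _ e) _; first by rewrite addr_ge0// invr_ge0 ltW.
  by rewrite le_eqVlt; apply/orP; left; apply/eqP; ring.
split=> [eta eta0|/(levy_tail_ratio_lt1_tail hmu)[r [x1 [r1 x10 Tr]]] eta eta0].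
  set M := 2 * (2 + eta^-1) * K.
  have M0 : 0 < M by rewrite !mulr_gt0 ?addr_gt0 ?invr_gt0.
  set c := eta / (2 * (1 + eta)).
  have c0 : 0 < c by rewrite divr_gt0 ?mulr_gt0 ?addr_gt0.
  (* The killing rate is absorbed by [t q >= eta q], the tail by [c >= kappa M]. *)
  set kappa := Num.min eta (c / M).
  have k0 : 0 < kappa by rewrite lt_min eta0 divr_gt0.
  have [k1 k2] : kappa <= eta /\ kappa * M <= c.
    by rewrite -ler_pdivlMr// /kappa !ge_min !lexx orbT.
  exists (4 / (x0 * eta)), (kappa * (eta / (1 + eta))); split.
  - by rewrite divr_gt0 ?mulr_gt0.
  - by rewrite mulr_gt0// divr_gt0// addr_gt0.
  move=> t a etat ha z.
  have [a0 t0 xx0] := scale_lt _ _ _ _ eta0 etat x00 ha.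
  have [X0 XY] := norm_le _ _ _ eta0 etat a0 xx0.
  have T0 := tail_ge0 mu (2 / (a * t)).
  have gap : kappa * (re_exponent mu q a t + `|im_exponent mu a t|) <=
      t * re_exponent mu q a t - im_exponent mu a t.
    apply: (le_trans (ler_wpM2l (ltW k0) XY)).
    apply: le_trans (arg_exponent_ge hmu q a0 eta0 etat).
    rewrite mulrDr mulrA lerD ?ler_wpM2r//.
    exact: le_trans etat.
  have [e1 e2 e3] := carg_gap a0 (ltW t0) X0 (ltW k0) gap.
  have le_gap : kappa * (eta / (1 + eta)) / t <= kappa / (1 + t).
    rewrite -mulrA ler_wpM2l//; first exact: ltW.
    rewrite ler_pdivrMr// [leRHS]mulrC; exact: ratio_one_add_ge.
  rewrite /phi_star (laplace_exponent_kernels t hphi a0).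
  split=> //; first exact: le_trans le_gap e2.
  by apply: (le_trans e3); rewrite lerD2l lerN2.
set M := 2 * (2 + eta^-1) * K.
have M0 : 0 < M by rewrite !mulr_gt0 ?addr_gt0 ?invr_gt0.
set m := Num.min (1 / 2) (1 + cos 2) : R.
have m0 : 0 < m by rewrite lt_min one_add_cos2_gt0 divr_gt0.
(* Both terms of the lower bound carry a factor [t], which compensates
   [1 / (1 + t)]. *)
set kappa := Num.min 1 (m * (1 - r) / M).
have mr0 : 0 < m * (1 - r) by rewrite mulr_gt0// subr_gt0.
have k0 : 0 < kappa by rewrite lt_min ltr01 divr_gt0.
have [k1 k2] : kappa <= 1 /\ kappa * M <= m * (1 - r).
  by rewrite -ler_pdivlMr// /kappa !ge_min !lexx orbT.
have x20 : 0 < Num.min x0 x1 by rewrite lt_min x00.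
exists (4 / (Num.min x0 x1 * eta)), (kappa * (eta / (1 + eta))); split.
- by rewrite divr_gt0 ?mulr_gt0.
- by rewrite mulr_gt0// divr_gt0// addr_gt0.
move=> t a etat ha z.
have [a0 t0 xx0] := scale_lt _ _ _ _ eta0 etat x20 ha.
have [xx1 xx2] : 0 < 2 / (a * t) < x0 /\ 0 < 2 / (a * t) < x1.
  by move: xx0; rewrite lt_min => /and3P[-> -> ->].
have [X0 XY] := norm_le _ _ _ eta0 etat a0 xx1.
have T0 := tail_ge0 mu (2 / (a * t)).
have gap : kappa * t * (re_exponent mu q a t + `|im_exponent mu a t|) <=
    t * re_exponent mu q a t - im_exponent mu a t.
  have kt0 : 0 <= kappa * t by rewrite mulr_ge0// ltW.
  apply: (le_trans (ler_wpM2l kt0 XY)).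
  apply: le_trans (arg_exponent_window hmu q a0 t0).
  have tq : kappa * t * q <= t * q.
    by rewrite -mulrA ler_piMl// mulr_ge0// ltW.
  have kM : kappa * M * tail mu (2 / (a * t)) <=
      m * (1 - r) * tail mu (2 / (a * t)) by rewrite ler_wpM2r.
  have mT : m * tail mu (2 * (2 / (a * t))) <= m * (r * tail mu (2 / (a * t))).
    by rewrite ler_pM2l// Tr.
  have : t * (kappa * M * tail mu (2 / (a * t))) <=
      t * (m * (tail mu (2 / (a * t)) - tail mu (2 * (2 / (a * t))))).
    by rewrite ler_pM2l//; lra.
  rewrite -/m -/M; lra.
have kt0 : 0 <= kappa * t by rewrite mulr_ge0// ltW.
have [e1 e2 e3] := carg_gap a0 (ltW t0) X0 kt0 gap.
have le_gap : kappa * (eta / (1 + eta)) <= kappa * t / (1 + t).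
  rewrite -mulrA ler_wpM2l//; first exact: ltW.
  exact: ratio_one_add_ge.
rewrite /phi_star (laplace_exponent_kernels t hphi a0).
split=> //; first exact: le_trans le_gap e2.
by apply: (le_trans e3); rewrite lerD2l lerN2.
Qed.
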